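(* Let $E$ be a field of characteristic zero, $\mathfrak{g}$ a finite-dimensional simple Lie algebra over $E$, $\sigma\neq 1$ an involutive automorphism of $\mathfrak{g}$, and $\mathfrak{k}=\{x\in\mathfrak{g}:\sigma(x)=x\}$ the fixed point set of $\sigma$. Assume that $\mathfrak{k}$ is semisimple. Then any $\mathfrak{k}$-invariant subspace of $\mathfrak{g}$ containing $\mathfrak{k}$ is equal to $\mathfrak{k}$ or to $\mathfrak{g}$. In particular, $\mathfrak{k}$ is a maximal proper subalgebra of $\mathfrak{g}$.
   Context: An involutive automorphism is a Lie algebra automorphism $\sigma$ with $\sigma^2=1$. A subspace $V\subset\mathfrak{g}$ is $\mathfrak{k}$-invariant if $[\mathfrak{k},V]\subset V$. The Lie algebra $\mathfrak{g}$ is simple over $E$ (it is not assumed to remain simple after extension of scalars). The paper's convention also allows the one-dimensional Lie algebra as simple; the zero Lie algebra counts as semisimple. *)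

(* Defs.v *)
From HB Require Import structures.
From mathcomp Require Import all_boot all_order all_algebra.

Set Implicit Arguments.
Unset Strict Implicit.
Unset Printing Implicit Defensive.

Import GRing.Theory.
Local Open Scope ring_scope.

(* Finite-dimensional Lie algebras over a field.  The bracket is alternating
   rather than merely antisymmetric, so the axioms are the usual ones in every
   characteristic. *)
HB.mixin Record Vector_isLieAlgebra (E : fieldType) L of Vector E L := {
  lie : L -> L -> L;
  lie_linearl : forall y, linear (lie^~ y);
  lie_linearr : forall x, linear (lie x);
  lie_alt : forall x, lie x x = 0;
  lie_jacobi : forall x y z,
    lie x (lie y z) + lie y (lie z x) + lie z (lie x y) = 0
}.

#[short(type="lieAlgType")]
HB.structure Definition LieAlgebra (E : fieldType) :=
  {L of Vector_isLieAlgebra E L & Vector E L}.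

Section LieSubspaces.
Variables (E : fieldType) (g : lieAlgType E).
Implicit Types (U V W K I M : {vspace g}) (x y : g) (s : 'End(g)).

HB.instance Definition _ x := @GRing.isLinear.Build E g g *:%R (lie x)
  (lie_linearr x).

Definition lie_flip y x := lie x y.
HB.instance Definition _ y := @GRing.isLinear.Build E g g *:%R (lie_flip y)
  (lie_linearl y).

(* [U, V] is the linear span of the brackets [u, v] with u in U and v in V;
   by bilinearity, basis vectors suffice (see lie_prodvP). *)
Definition lie_prodv U V : {vspace g} :=
  <<[seq lie u v | u <- vbasis U, v <- vbasis V]>>%VS.

Lemma lie_prodvP U V W :
  reflect (forall u v, u \in U -> v \in V -> lie u v \in W)
          (lie_prodv U V <= W)%VS.
Proof.
apply: (iffP span_subvP) => [sUVW u v uU vV | UVW w].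
  rewrite (coord_vbasis uU) (coord_vbasis vV).
  rewrite -[lie _ _]/(lie_flip _ _) linear_sum.
  apply: memv_suml => i _; rewrite linearZ memvZ //= /lie_flip linear_sum.
  apply: memv_suml => j _; rewrite linearZ memvZ //=; apply: sUVW.
  by apply/allpairsP; exists ((vbasis U)`_i, (vbasis V)`_j) => /=; rewrite !mem_nth ?size_tuple.
by case/allpairsP=> -[u v] /= [/vbasis_mem uU /vbasis_mem vV ->]; apply: UVW.
Qed.

Definition is_subalgebra K := (lie_prodv K K <= K)%VS.

Definition is_invariant K V := (lie_prodv K V <= V)%VS.

Definition is_ideal K I := (I <= K)%VS && is_invariant K I.

Definition lie_derived n K := iter n (fun U => lie_prodv U U) K.

Definition lie_solvable K := exists n, lie_derived n K = 0%VS.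

(* Vanishing of the radical; the zero algebra is semisimple. *)
Definition lie_semisimple K :=
  forall I, is_ideal K I -> lie_solvable I -> I = 0%VS.

(* Commutativity is not excluded: the one-dimensional algebra is simple. *)
Definition lie_simple K :=
  K <> 0%VS /\ forall I, is_ideal K I -> I = 0%VS \/ I = K.

Definition is_lie_automorphism s :=
  bijective s /\ {morph s : x y / lie x y}.

Definition is_maximal_subalgebra K :=
  [/\ is_subalgebra K, K <> fullv &
      forall M, is_subalgebra M -> (K <= M)%VS -> M = K \/ M = fullv].

End LieSubspaces.

(* Main.v *)
Require Import Defs.
From HB Require Import structures.
From Stdlib Require Import Classical.
From mathcomp Require Import all_boot all_order all_algebra all_field.
From mathcomp Require Import ring.

(** Write g = k + p for the eigenspaces of sigma, and B for the Killing form.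

    B is nondegenerate unless g is abelian.  Otherwise B = 0, and then every
    ad x is nilpotent: over a splitting field, each rational solution (c_i) of
    the additive relations among the eigenvalues l_i of ad x gives the
    derivation with value c_i on the l_i-generalised eigenspace, and tr (ad x D)
    = 0 for every derivation D; positivity over the rationals forces all the
    l_i to vanish.  Engel's argument then yields a nonzero central element.

    Since B is nondegenerate on k, semisimplicity gives k = [k, k], so elements
    of k act without trace on every k-module.  Let W be the intersection of V
    and p, and N the intersection of W with its orthogonal.  Then [N, N] is
    orthogonal to k, so it is zero, and for x in N and y in p the number B(x, y)
    is a combination of traces of [x, y] on N and on p, so it vanishes.  Hence
    N = 0 and p = W + W' with W' orthogonal to W; as [W, W'] = 0, the subspace
    W + [W, W] is an ideal of g, which is 0 or g. *)

Set Implicit Arguments.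
Unset Strict Implicit.
Unset Printing Implicit Defensive.

Import Order.TTheory GRing.Theory Num.Theory.
Import VectorInternalTheory.

Local Open Scope ring_scope.

(** * Nilpotency from traces against derivations *)

Lemma pchar0_intr_eq0 (K : fieldType) : [pchar K] =i pred0 ->
  forall z : int, ((z%:~R : K) == 0) = (z == 0).
Proof.
move=> /pcharf0P ch0 [n|n]; first by rewrite -pmulrn ch0.
by rewrite NegzE mulrNz oppr_eq0 -pmulrn ch0.
Qed.

Lemma pchar0_rat_morphism (K : fieldType) :
  [pchar K] =i pred0 -> inhabited {rmorphism rat -> K}.
Proof.
move=> /pchar0_intr_eq0 ch0.
(* [ratr] is defined from the reduced fraction; computing it from any fraction equal to [x] turns
   both morphism laws into integer identities over a common denominator. *)
have frac (x : rat) (p q : int) : q != 0 -> x * q%:~R = p%:~R ->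
    ratr x * q%:~R = p%:~R :> K.
  move=> q0 xq; apply: (@mulIf _ (denq x)%:~R); first by rewrite ch0 denq_eq0.
  rewrite mulrAC divfK ?ch0 ?denq_eq0 // -!intrM; congr _%:~R.
  by apply: (@intr_inj rat); rewrite !intrM -xq numqE mulrAC.
have num x : ratr x * (denq x)%:~R = (numq x)%:~R :> K.
  by rewrite divfK ?ch0 ?denq_eq0.
have fD : zmod_morphism (@ratr K).
  move=> x y; have dxy : denq x * denq y != 0 by rewrite mulf_neq0 ?denq_eq0.
  apply: (@mulIf _ (denq x * denq y)%:~R); first by rewrite ch0.
  rewrite (frac _ (numq x * denq y - numq y * denq x)) //.
    by rewrite rmorphB /= !intrM -!num; ring.
  by rewrite rmorphB /= !intrM !numqE; ring.
have fM : monoid_morphism (@ratr K).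
  split=> [|x y]; first by rewrite (ratr_int K 1).
  have dxy : denq x * denq y != 0 by rewrite mulf_neq0 ?denq_eq0.
  apply: (@mulIf _ (denq x * denq y)%:~R); first by rewrite ch0.
  rewrite (frac _ (numq x * numq y)) //; first by rewrite !intrM -!num; ring.
  by rewrite !intrM !numqE; ring.
pose f : {rmorphism rat -> K} := HB.pack (@ratr K)
  (GRing.isZmodMorphism.Build _ _ _ fD) (GRing.isMonoidMorphism.Build _ _ _ fM).
exact: inhabits f.
Qed.

(* The Gram matrix of the rational solution space for the weights [w] has only
   those null vectors that vanish on the support of [w]; both kernels commute
   with scalar extension. *)
Lemma orthogonal_rational_solutions (K : fieldType) (f : {rmorphism rat -> K})
    r m (A : 'M[rat]_(r, m)) (l : 'rV[K]_r) (w : 'I_r -> nat) :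
    l *m map_mx f A = 0 ->
    (forall c : 'rV[rat]_r, c *m A = 0 ->
       \sum_i (w i)%:R * l 0 i * f (c 0 i) = 0) ->
  forall i, w i != 0%N -> l 0 i = 0.
Proof.
move=> lA lc i wi; pose S := kermx A.
have /submxP[u lE] : (l <= map_mx f S)%MS.
  by rewrite /S map_kermx; apply/sub_kermxP.
pose M : 'M[rat]_r := diag_mx (\row_i (w i)%:R).
pose G := S *m M *m S^T.
have uG : u *m map_mx f G = 0.
  rewrite /G -mulmxA map_mxM mulmxA -lE; apply/rowP=> j; rewrite !mxE.
  have := lc (row j S); rewrite -row_mul mulmx_ker row0 => /(_ erefl) {2}<-.
  apply: eq_bigr => k _; rewrite mul_diag_mx !mxE rmorphM rmorph_nat.
  by rewrite mulrCA mulrA.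
have /submxP[v uE] : (u <= map_mx f (kermx G))%MS.
  by rewrite map_kermx; apply/sub_kermxP.
pose T := kermx G *m S.
(* A row t of [T] is a rational solution with sum_j w_j t_j^2 = 0, so it vanishes wherever w does
   not; and [l] is a K-combination of such rows. *)
have T0 a : T a i = 0.
  have : (T *m M *m T^T) a a = 0.
    have -> : T *m M *m T^T = kermx G *m G *m (kermx G)^T.
      by rewrite /T (trmx_mul _ S) -!mulmxA.
    by rewrite mulmx_ker mul0mx mxE.
  rewrite mxE => /eqP.
  rewrite psumr_eq0 => [/allP/(_ i (mem_index_enum _))|j _];
    rewrite mul_mx_diag !mxE mulrAC.
    by rewrite !mulf_eq0 pnatr_eq0 (negPf wi) orbF orbb => /eqP.
  by rewrite mulr_ge0 ?ler0n // -expr2 sqr_ge0.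
rewrite lE uE -mulmxA -map_mxM mxE big1 // => a _.
by rewrite mxE T0 rmorph0 mulr0.
Qed.

Lemma bezout_pairwise_coprime (K : fieldType) (I : eqType) (q : I -> {poly K})
    (s : seq I) : (forall i j, i != j -> coprimep (q i) (q j)) -> uniq s ->
    s != [::] ->
  exists u : I -> {poly K},
    \sum_(i <- s) u i * \prod_(j <- s | j != i) q j = 1.
Proof.
move=> co; elim: s => // x s IH /= /andP[xs us] _.
case: (eqVneq s [::]) => [->|s0].
  by exists (fun=> 1); rewrite big_seq1 big_cons eqxx big_nil mul1r.
have [u su] := IH us s0.
have /Bezout_eq1_coprimepP[[a b] /= ab] : coprimep (q x) (\prod_(j <- s) q j).
  rewrite big_seq; apply: (big_ind (coprimep (q x))) => [|p1 p2 c1 c2|i si].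
  - exact: coprimep1.
  - by rewrite coprimepMr c1.
  - by apply: co; apply: contraNneq xs => ->.
(* In a q_x + b prod_(j in s) q_j = 1, multiply the first term by the identity already known for
   s. *)
exists (fun i => if i == x then b else a * u i).
rewrite big_cons eqxx big_cons eqxx /= -[RHS]ab addrC.
congr (_ + _); last first.
  congr (b * _); rewrite big_seq_cond [RHS]big_seq. apply: eq_bigl => i.
  by rewrite andb_idr // => si; apply: contraNneq xs => <-.
rewrite -[RHS]mulr1 -[in RHS]su mulr_sumr [LHS]big_seq [RHS]big_seq.
apply: eq_bigr => i si; have ix : (x == i) = false.
  by apply: contraNF xs => /eqP->.
by rewrite eq_sym ix big_cons ix /=; ring.
Qed.

(** The [P i] are the values at [X] of the Bezout terms for the pairwise coprime powers (T - a_i)^N.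
    They sum to 1, and the product of two distinct ones is a multiple of the annihilating
    polynomial. *)
Lemma primary_idempotents (K : fieldType) n (X : 'M[K]_n.+1) (I : finType)
    (a : I -> K) N : injective a ->
    horner_mx X (\prod_i ('X - (a i)%:P) ^+ N) = 0 ->
  exists P : I -> 'M[K]_n.+1,
    [/\ forall i, X * P i = P i * X,
        \sum_i P i = 1,
        forall i j, i != j -> P i * P j = 0 &
        forall i, P i * (X - (a i)%:M) ^+ N = 0].
Proof.
move=> inj_a; pose q i := ('X - (a i)%:P) ^+ N.
rewrite -/(\prod_i q i) => X0.
case: (pickP I) => [i0 _|I0]; last first.
  by move: X0; rewrite big_pred0 // rmorph1 => /eqP; rewrite oner_eq0.
have co i j : i != j -> coprimep (q i) (q j).
  move=> ij; apply/coprimep_expl/coprimep_expr.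
  by rewrite coprimep_XsubC root_XsubC (inj_eq inj_a) eq_sym.
have := bezout_pairwise_coprime co (index_enum_uniq I).
have sI0 : index_enum I != [::].
  by apply: contraTneq (mem_index_enum i0) => ->.
case/(_ sI0) => u u1; pose p i := u i * \prod_(j | j != i) q j.
exists (fun i => horner_mx X (p i)).
have hq i : horner_mx X (q i) = (X - (a i)%:M) ^+ N.
  by rewrite rmorphXn rmorphB /= horner_mx_X horner_mx_C.
have prodq i : \prod_j q j = q i * \prod_(j | j != i) q j by rewrite (bigD1 i).
split=> [i||i j ij|i].
- by rewrite -{1 4}(horner_mx_X X) -!rmorphM mulrC.
- by rewrite -rmorph_sum u1 rmorph1.
- rewrite -rmorphM /p /= (bigD1 j) 1?eq_sym //=.
  set A := \prod_(k | _) _.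
  have -> : u i * (q j * A) * (u j * \prod_(k | k != j) q k) =
            (u i * A * u j) * \prod_k q k by rewrite (prodq j); ring.
  by rewrite rmorphM /= X0 mulr0.
- by rewrite -hq -rmorphM /p -mulrA [_ * q i]mulrC -prodq rmorphM /= X0 mulr0.
Qed.

(** Induction on the size. An invertible nilpotent matrix has size 0; otherwise a rank factorisation
    A = C B gives tr A = tr (B C), where B C is smaller and again nilpotent since (B C)^(M+1) = B
    A^M C. *)
Lemma mxtrace_nilpotent (K : fieldType) n (A : 'M[K]_n) N :
  iter N (mulmx A) 1%:M = 0 -> \tr A = 0.
Proof.
elim/ltn_ind: n A N => n IH A N AN.
have : (\rank A <= n)%N := rank_leq_row A.
rewrite leq_eqVlt => /orP[/eqP rA|lt].
  have uA : A \in unitmx by rewrite -row_free_unit /row_free rA.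
  have : iter N (mulmx A) 1%:M \in unitmx.
    by elim: N {AN} => [|N IHN] /=; rewrite ?unitmx1 // unitmx_mul uA.
  rewrite AN => u0; have : 0 = 1%:M :> 'M[K]_n by rewrite -(mulVmx u0) mulmx0.
  case: n {IH rA uA u0 AN} A => [|n] A; first by rewrite /mxtrace big_ord0.
  by move/matrixP/(_ 0 0)/eqP; rewrite !mxE eq_sym oner_eq0.
rewrite -(mulmx_base A) mxtrace_mulC; apply: (IH _ lt _ N.+1).
have main r (C : 'M_(n, r)) (B : 'M_(r, n)) M : C *m B = A ->
    iter M.+1 (mulmx (B *m C)) 1%:M = B *m iter M (mulmx A) 1%:M *m C.
  move=> CB; elim: M => [|M IHM]; first by rewrite /= !mulmx1.
  by rewrite iterS IHM /= -CB !mulmxA.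
by rewrite main ?mulmx_base // AN mulmx0 mul0mx.
Qed.

(** In a rank factorisation P = C B, cancelling C and B in P P = P leaves B C = 1, of trace the
    rank. *)
Lemma mxtrace_idempotent (K : fieldType) n (P : 'M[K]_n) :
  P *m P = P -> \tr P = (\rank P)%:R.
Proof.
have main r (C : 'M_(n, r)) (B : 'M_(r, n)) : row_full C -> row_free B ->
    C *m B = P -> P *m P = P -> \tr P = r%:R.
  move=> fC fB <- PP; rewrite mxtrace_mulC -mxtrace1; congr (\tr _).
  apply: (row_free_inj fB); apply: (row_full_inj fC).
  by rewrite mul1mx -[RHS]PP !mulmxA.
exact: main (col_base_full P) (row_base_free P) (mulmx_base P).
Qed.

(* [v *m a u] is the product of an algebra on row vectors, and [D] acts on the
   right. *)
Definition derivation (K : fieldType) n (a : 'rV[K]_n -> 'M[K]_n) (D : 'M_n) :=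
  forall v, a v *m D - D *m a v = a (v *m D).

(** By the Leibniz rule, X - (l + k) sends a product to a sum of two products, one with X - l
    applied to the first factor and one with X - k applied to the second. Each step thus lowers M or
    N by one. *)
Lemma derivation_generalised_eigen (K : fieldType) n
    (a : 'rV[K]_n.+1 -> 'M[K]_n.+1) (X : 'M_n.+1) (l k : K) M N v
    (U : 'M_n.+1) :
    linear a -> derivation a X ->
    U *m (X - l%:M) ^+ M = 0 -> v *m (X - k%:M) ^+ N = 0 ->
  U *m a v *m (X - (l + k)%:M) ^+ (M + N) = 0.
Proof.
move=> a_lin aX; have a0 : a 0 = 0.
  by have := a_lin (-1) 0 0; rewrite !scaler0 addr0 scaleN1r addNr.
have [s] := ubnP (M + N)%N.
elim: s M N U v => // s IH [|M] [|N] U v; rewrite ltnS => lt;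
  try by rewrite ?expr0 ?mulmx1 => U0 v0; rewrite ?U0 ?v0 ?a0 !(mulmx0, mul0mx).
have step : U *m a v *m (X - (l + k)%:M) =
    U *m (X - l%:M) *m a v + U *m a (v *m (X - k%:M)).
  have -> : v *m (X - k%:M) = (- k) *: v + v *m X.
    by rewrite mulmxBr mul_mx_scalar addrC scaleNr.
  rewrite a_lin -aX !(mulmxDr, mulmxDl, mulmxN, mulNmx, mulmxA, mul_mx_scalar).
  rewrite -scalemxAl -scalemxAr.
  move: (U *m a v) (U *m X *m a v) (U *m a v *m X) => p q r.
  by apply/matrixP=> i j; rewrite !mxE; ring.
move=> Ul vk; rewrite addSn exprS mulmxA step mulmxDl.
have -> : U *m (X - l%:M) *m a v *m (X - (l + k)%:M) ^+ (M + N.+1) = 0.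
  by apply: IH => //; rewrite -mulmxA mulmxE -exprS.
rewrite add0r -addSnnS; apply: IH; rewrite ?addSnnS //.
by rewrite -mulmxA mulmxE -exprS.
Qed.

Lemma row_kernel_coprime (K : fieldType) n (X : 'M[K]_n.+1) (p q : {poly K})
    (U : 'M_n.+1) : coprimep p q ->
  U *m horner_mx X p = 0 -> U *m horner_mx X q = 0 -> U = 0.
Proof.
case/Bezout_eq1_coprimepP=> [[b c] /= bc] Up Uq.
have kill r r' : U *m horner_mx X r = 0 -> U *m horner_mx X (r' * r) = 0.
  by move=> Ur; rewrite mulrC rmorphM /= -mulmxE mulmxA Ur mul0mx.
have : U *m horner_mx X 1 = 0 by rewrite -bc rmorphD mulmxDr !kill ?addr0.
by rewrite rmorph1 mulmx1.
Qed.

Lemma nilpotent_of_trace_derivation (K : fieldType) n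
    (a : 'rV[K]_n.+1 -> 'M[K]_n.+1) (X : 'M_n.+1) (s : seq K) :
    [pchar K] =i pred0 -> linear a -> derivation a X ->
    (forall D, derivation a D -> \tr (X *m D) = 0) ->
    char_poly X = \prod_(z <- s) ('X - z%:P) ->
  exists N, X ^+ N = 0.
Proof.
move=> ch0 a_lin aX trX Xs; pose N := size s; pose t := undup s.
pose I := 'I_(size t); pose l (i : I) := t`_i.
have l_inj : injective l.
  move=> i j /eqP; rewrite nth_uniq ?undup_uniq // => /eqP; exact: val_inj.
have X0 : horner_mx X (\prod_i ('X - (l i)%:P) ^+ N) = 0.
  have : char_poly X %| \prod_i ('X - (l i)%:P) ^+ N.
    rewrite Xs -prodr_undup_exp_count big_tnth.
    apply: (big_ind2 (fun p q => p %| q)) => // [p1 q1 p2 q2|i _].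
      exact: dvdp_mul.
    by rewrite /l (tnth_nth 0) /= dvdp_exp2l ?count_size.
  by case/dvdpP=> q ->; rewrite rmorphM /= Cayley_Hamilton mulr0.
have [P [XP P1 PP PX]] := primary_idempotents l_inj X0.
have PPi i : P i *m P i = P i.
  rewrite -[RHS]mulmx1 -[1%:M]P1 mulmx_sumr.
  rewrite (bigD1 i) //= big1 ?addr0 // => j ji.
  by rewrite -[LHS]/(P i * P j) PP // eq_sym.
(* (X - l_i) P_i is nilpotent, hence traceless, so only l_i tr P_i remains. *)
have trXP i : \tr (X *m P i) = l i * (\rank (P i))%:R.
  rewrite -(mxtrace_idempotent (PPi i)) -mxtraceZ -mul_scalar_mx.
  apply/eqP; rewrite -subr_eq0 -raddfB /= -mulmxBl; apply/eqP.
  have cXP : GRing.comm (X - (l i)%:M) (P i).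
    by rewrite /GRing.comm mulrBl mulrBr XP -!mulmxE scalar_mxC.
  apply: (@mxtrace_nilpotent _ _ _ N.+1).
  have -> M : iter M (mulmx ((X - (l i)%:M) *m P i)) 1%:M =
              ((X - (l i)%:M) * P i) ^+ M.
    by elim: M => [|M IH] //; rewrite iterS exprS IH.
  rewrite cXP exprMn_comm; last exact: commr_sym.
  by rewrite !exprSr -mulrA [P i * _]mulrA PX mul0r mulr0.
(* The product lies in the generalised eigenspace for l_i + l_j, and its [P k] component in the one
   for l_k; distinct eigenvalues give coprime annihilators. *)
have PaP i j k v : l i + l j != l k -> P i *m a (v *m P j) *m P k = 0.
  move=> ijk; apply: (@row_kernel_coprime _ _ X
    (('X - (l i + l j)%:P) ^+ (N + N)) (('X - (l k)%:P) ^+ N)).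
  - apply/coprimep_expl/coprimep_expr.
    by rewrite coprimep_XsubC root_XsubC eq_sym.
  - rewrite rmorphXn rmorphB /= horner_mx_X horner_mx_C.
    have cP : GRing.comm (P k) ((X - (l i + l j)%:M) ^+ (N + N)).
      apply/commrX/commrB; first by rewrite /GRing.comm XP.
      by rewrite /GRing.comm -!mulmxE scalar_mxC.
    rewrite -(mulmxA _ (P k)) -[P k *m _]/(P k * _) cP.
    rewrite -[_ * P k]/(_ *m P k) mulmxA.
    rewrite (derivation_generalised_eigen a_lin aX (PX i)) ?mul0mx //.
    by rewrite -(mulmxA v) -[P j *m _]/(P j * _) PX mulmx0.
  - rewrite rmorphXn rmorphB /= horner_mx_X horner_mx_C -(mulmxA _ (P k)).
    by rewrite -[P k *m _]/(P k * _) PX mulmx0.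
have a_sum (J : finType) (u : J -> 'rV_n.+1) :
    a (\sum_j u j) = \sum_j a (u j).
  have aD u1 u2 : a (u1 + u2) = a u1 + a u2.
    by rewrite -[u1]scale1r a_lin !scale1r.
  apply: big_morph => //; have := aD 0 0; rewrite addr0 => /eqP.
  by rewrite -subr_eq0 opprD addrA subrr sub0r oppr_eq0 => /eqP.
have aZ c u : a (c *: u) = c *: a u.
  have a0 : a 0 = 0 by have := a_sum void (fun=> 0); rewrite !big_pred0.
  by rewrite -[c *: u]addr0 a_lin a0 addr0.
(* The eigenvalues themselves satisfy the additive relations required of [c]. *)
have der_sum (c : I -> K) :
    (forall i j k, l i + l j = l k -> c i + c j = c k) ->
    derivation a (\sum_i c i *: P i).
  move=> cl v; set D := \sum_i _.
  have DP k : D *m P k = c k *: P k.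
    rewrite mulmx_suml (bigD1 k) //= big1 ?addr0 => [|i ik].
      by rewrite -scalemxAl PPi.
    by rewrite -scalemxAl mulmxE PP // scaler0.
  have PD k : P k *m D = c k *: P k.
    rewrite mulmx_sumr (bigD1 k) //= big1 ?addr0 => [|i ik].
      by rewrite -scalemxAr PPi.
    by rewrite -scalemxAr mulmxE PP 1?eq_sym // scaler0.
  suff comp i j k : P i *m (a (v *m P j) *m D - D *m a (v *m P j)) *m P k =
      P i *m a (v *m P j *m D) *m P k.
    have dec (B : 'M_n.+1) : B = \sum_i \sum_k P i *m B *m P k.
      rewrite -{1}[B]mulmx1 -{1}[B]mul1mx -{1}[1%:M]P1 -[1%:M]P1.
      rewrite !mulmx_suml; apply: eq_bigr => i _.
      by rewrite mulmx_sumr.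
    have vP : v = \sum_j v *m P j by rewrite -mulmx_sumr P1 mulmx1.
    rewrite {1 2 3}vP mulmx_suml !a_sum mulmx_suml mulmx_sumr -sumrB.
    apply: eq_bigr => j _; rewrite [LHS]dec [RHS]dec.
    by apply: eq_bigr => i _; apply: eq_bigr => k _.
  rewrite -(mulmxA v) PD -scalemxAr aZ mulmxBr mulmxBl.
  rewrite -!mulmxA DP !mulmxA PD -!scalemxAr -!scalemxAl.
  have [e|ne] := eqVneq (l i + l j) (l k).
    by rewrite -(cl _ _ _ e) scalerDl addrC addKr.
  by rewrite PaP // !scaler0 subr0.
have [f] := pchar0_rat_morphism ch0.
pose T := (I * I * I)%type.
pose e (m : 'I_#|{: T}|) : T := enum_val m.
(* [A] has one column per triple (i, j, k), expressing c_i + c_j - c_k when l_i + l_j = l_k and zero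
   otherwise. So [c *m A = 0] says that c satisfies every such relation among the eigenvalues;
   [Asum] serves both for l over K and for rational c. *)
pose good (x : T) := l x.1.1 + l x.1.2 == l x.2.
pose A : 'M[rat]_(size t, #|{: T}|) := \matrix_(i, m)
  ((good (e m))%:R *
    ((i == (e m).1.1)%:R + (i == (e m).1.2)%:R - (i == (e m).2)%:R)).
have Asum (F : fieldType) (h : {rmorphism rat -> F}) (c : 'rV[F]_(size t)) m :
    (c *m map_mx h A) 0 m =
    (good (e m))%:R * (c 0 (e m).1.1 + c 0 (e m).1.2 - c 0 (e m).2).
  have sel k : \sum_i c 0 i * (i == k)%:R = c 0 k.
    rewrite (bigD1 k) //= eqxx mulr1 big1 ?addr0 // => i /negPf->.
    by rewrite mulr0.
  rewrite -!sel -sumrN -!big_split mulr_sumr mxE; apply: eq_bigr => i _ /=.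
  by rewrite !mxE !(rmorphM, rmorphB, rmorphD, rmorph_nat); ring.
have lw : forall i, \rank (P i) != 0%N ->
    (\row_j l j : 'rV[K]_(size t)) 0 i = 0.
  apply: (@orthogonal_rational_solutions _ f _ _ A).
    apply/rowP=> m; rewrite Asum !mxE /good.
    by case: eqP => [->|_]; rewrite ?subrr ?mulr0 ?mul0r.
  move=> c cA; pose d i := f (c 0 i).
  have /trX : derivation a (\sum_i d i *: P i).
    apply: der_sum => i j k ijk; pose m := enum_rank ((i, j), k).
    have := Asum rat idfun c m.
    have -> : map_mx idfun A = A by apply/matrixP=> ? ?; rewrite !mxE.
    rewrite cA mxE /good /e enum_rankK /= ijk eqxx mul1r => /esym/eqP.
    by rewrite subr_eq0 /d -rmorphD => /eqP->.
  rewrite mulmx_sumr raddf_sum => tr0; rewrite -[RHS]tr0.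
  apply: eq_bigr => i _ /=.
  by rewrite -scalemxAr mxtraceZ trXP mxE mulrC [X in _ * X]mulrC.
exists N; rewrite -[X ^+ N]mul1r -P1 mulr_suml big1 // => i _.
have [/eqP|ri] := eqVneq (\rank (P i)) 0%N.
  by rewrite mxrank_eq0 => /eqP->; rewrite mul0r.
by have := PX i; have := lw i ri; rewrite mxE => ->; rewrite raddf0 subr0.
Qed.

(** Descend through proper divisors to an irreducible one and adjoin a root of it; excluded middle
    decides irreducibility over an arbitrary field. *)
Lemma root_extension (F : fieldType) (p : {poly F}) : (1 < size p)%N ->
  exists (K : fieldType) (f : {rmorphism F -> K}) (z : K),
    root (map_poly f p) z.
Proof.
have [m] := ubnP (size p); elim: m p => // m IH p lt p1.
have [irr|red] := classic (irreducible_poly p).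
  have [K _ [z pz _]] := irredp_FAdjoin irr.
  by exists K, (in_alg K), z.
have [q [q1 qp lpq]] : exists q : {poly F},
    [/\ (1 < size q)%N, q %| p & (size q < size p)%N].
  have p0 : p != 0 by rewrite -size_poly_gt0 ltnW.
  apply: NNPP => nq; apply: red; split=> // q q1 qp.
  rewrite -dvdp_size_eqp // eqn_leq dvdp_leq //= leqNgt.
  apply/negP=> lpq; apply: nq; exists q; split=> //.
  by rewrite ltn_neqAle eq_sym q1 size_poly_gt0 (dvdpN0 qp).
have [K [f [z qz]]] := IH q (leq_trans lpq lt) q1.
exists K, f, z; apply: (root_dvdp _ qz); by rewrite dvdp_map.
Qed.

Lemma splitting_extension (F : fieldType) (p : {poly F}) : p \is monic ->
  exists (K : fieldType) (f : {rmorphism F -> K}) (s : seq K),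
    map_poly f p = \prod_(z <- s) ('X - z%:P).
Proof.
have [m] := ubnP (size p); elim: m F p => // m IH F p lt pm.
have [p1|p1] := leqP (size p) 1.
  exists F, idfun, [::]; rewrite big_nil map_poly_id //; apply/eqP.
  rewrite -eqp_monic ?monic1 // -size_poly_eq1 eqn_leq p1.
  by rewrite size_poly_gt0 monic_neq0.
have [K [f [z /factor_theorem[q pq]]]] := root_extension p1.
have qm : q \is monic by rewrite -(monicMr _ (monicXsubC z)) -pq map_monic.
have szq : (size q < m)%N.
  have := congr1 (size \o polyseq) pq.
  rewrite /= size_map_poly size_monicM ?monicXsubC //.
    by rewrite size_XsubC addn2 /= => e; rewrite -ltnS -e.
  by rewrite polyXsubC_eq0.
have [L [h [s qs]]] := IH K q szq qm.
exists L, (h \o f), (h z :: s).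
rewrite map_poly_comp pq rmorphM rmorphB /= qs map_polyX map_polyC big_cons.
by rewrite mulrC.
Qed.

(* The sum is a general element of the derived algebra of the Lie algebra with
   product [y *m a z]. *)
Lemma cartan_nilpotent (E : fieldType) n (a : 'rV[E]_n -> 'M[E]_n)
    (I : finType) (c : I -> E) (b : I -> 'rV[E]_n) :
    [pchar E] =i pred0 -> linear a ->
    (forall y z, a y *m a z - a z *m a y = a (y *m a z)) ->
    (forall y z, \tr (a y *m a z) = 0) ->
    (forall i, exists y z, b i = y *m a z) ->
  exists N, iter N (mulmx (a (\sum_i c i *: b i))) 1%:M = 0.
Proof.
case: n a b => [|n] a b ch0 a_lin aB tr0 bE.
  by exists 0%N; apply/matrixP=> -[].
set x := \sum_i _; set X := a x.
have [K [f [s Xs]]] := splitting_extension (char_poly_monic X).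
rewrite map_char_poly in Xs.
have aZ0 : a 0 = 0.
  by have := a_lin (-1) 0 0; rewrite !scaler0 addr0 scaleN1r addNr.
have aD u v : a (u + v) = a u + a v by rewrite -[u]scale1r a_lin !scale1r.
have aZ k u : a (k *: u) = k *: a u by rewrite -[k *: u]addr0 a_lin aZ0 addr0.
have aS (J : finType) (u : J -> 'rV_n.+1) : a (\sum_j u j) = \sum_j a (u j).
  exact: big_morph.
(* Extension of scalars of the product from E to K, defined on the standard basis. *)
pose aK (v : 'rV[K]_n.+1) := \sum_i v 0 i *: map_mx f (a (delta_mx 0 i)).
have aK_lin : linear aK.
  move=> k u v; rewrite /aK scaler_sumr -big_split; apply: eq_bigr => i _ /=.
  by rewrite !mxE scalerDl scalerA.
have aKf v : map_mx f (a v) = aK (map_mx f v).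
  rewrite {1}[v]row_sum_delta aS raddf_sum; apply: eq_bigr => i _ /=.
  by rewrite aZ map_mxZ mxE.
have aKB v y : aK v *m map_mx f (a y) - map_mx f (a y) *m aK v =
    aK (v *m map_mx f (a y)).
  rewrite {1 2}/aK mulmx_suml mulmx_sumr -sumrB.
  have -> : v *m map_mx f (a y) =
      \sum_i v 0 i *: map_mx f (delta_mx 0 i *m a y).
    rewrite {1}[v]row_sum_delta mulmx_suml; apply: eq_bigr => i _.
    by rewrite -scalemxAl map_mxM map_delta_mx.
  have aKS (J : finType) (k : J -> K) u :
      aK (\sum_j k j *: u j) = \sum_j k j *: aK (u j).
    have aK0 : aK 0 = 0.
      by have := aK_lin (-1) 0 0; rewrite !scaler0 addr0 scaleN1r addNr.
    have aKD w1 w2 : aK (w1 + w2) = aK w1 + aK w2.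
      by rewrite -[w1]scale1r aK_lin !scale1r.
    rewrite (big_morph _ aKD aK0); apply: eq_bigr => j _.
    by rewrite -[k j *: _]addr0 aK_lin aK0 addr0.
  rewrite aKS; apply: eq_bigr => i _.
  by rewrite -aKf -aB map_mxB !map_mxM -scalemxAl -scalemxAr scalerBr.
have tr0K y v : \tr (map_mx f (a y) *m aK v) = 0.
  rewrite /aK mulmx_sumr raddf_sum big1 // => i _ /=.
  by rewrite -scalemxAr mxtraceZ -map_mxM trace_map_mx tr0 rmorph0 mulr0.
have chK : [pchar K] =i pred0 by move=> p; rewrite (fmorph_pchar f).
have [|D aD0|N XN] := nilpotent_of_trace_derivation (a := aK) chK aK_lin _ _ Xs.
  by move=> v; apply: aKB.
  have -> : map_mx f X = \sum_i map_mx f (a (c i *: b i)).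
    by rewrite /X /x aS raddf_sum.
  rewrite mulmx_suml raddf_sum big1 // => i _ /=.
  have [y [z ->]] := bE i.
  (* Here a (y a(z)) is the commutator of a(y) and a(z), so its trace against D is tr (a(y) (a(z) D
     - D a(z))). As D is a derivation, the inner factor is again a value of [aK], and the trace form
     vanishes. *)
  rewrite aZ map_mxZ -scalemxAl mxtraceZ -aB map_mxB !map_mxM mulmxBl raddfB /=.
  rewrite -!mulmxA [X in _ - X]mxtrace_mulC -mulmxA.
  by rewrite -raddfB -mulmxBr (aKf z) aD0 /= tr0K mulr0.
exists N; have -> : iter N (mulmx X) 1%:M = X ^+ N.
  by elim: (N) => // M IH; rewrite iterS IH exprS.
apply/eqP; rewrite -(map_mx_eq0 f) rmorphXn /=; exact/eqP.
Qed.

(** * Engel's theorem and the Killing form *)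

Section LieTheory.
Variables (E : fieldType) (g : lieAlgType E).
Implicit Types (U V W K M : {vspace g}) (x y z u v w : g).

Lemma lieDl x y z : lie (x + y) z = lie x z + lie y z.
Proof. exact: (linearD (lie_flip z)). Qed.

Lemma lieDr x y z : lie x (y + z) = lie x y + lie x z.
Proof. exact: linearD. Qed.

Lemma lieZl (c : E) x z : lie (c *: x) z = c *: lie x z.
Proof. exact: (linearZ_LR (lie_flip z)). Qed.

Lemma lieZr (c : E) x z : lie x (c *: z) = c *: lie x z.
Proof. exact: linearZ_LR. Qed.

Lemma lie0l x : lie 0 x = 0.
Proof. exact: (linear0 (lie_flip x)). Qed.

Lemma lie0r x : lie x 0 = 0.
Proof. exact: linear0. Qed.

Lemma lieNr x y : lie x (- y) = - lie x y.
Proof. exact: linearN. Qed.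

Lemma lieC x y : lie x y = - lie y x.
Proof.
have := lie_alt (x + y); rewrite lieDl !lieDr !lie_alt add0r addr0.
by move/eqP; rewrite addr_eq0 => /eqP.
Qed.

Lemma lieNl x y : lie (- x) y = - lie x y.
Proof. by rewrite lieC lieNr -lieC. Qed.

Lemma lie_leibniz x y z : lie x (lie y z) = lie (lie x y) z + lie y (lie x z).
Proof.
rewrite [lie (lie x y) z]lieC [lie x z]lieC lieNr -opprD.
by apply/eqP; rewrite -addr_eq0 addrA addrAC lie_jacobi.
Qed.

Lemma mem_lie_prodv U V u v : u \in U -> v \in V -> lie u v \in lie_prodv U V.
Proof. by move=> uU vV; apply: (lie_prodvP _ _ _ (subvv _)). Qed.

Lemma invariantP K V :
  reflect (forall x v, x \in K -> v \in V -> lie x v \in V) (is_invariant K V).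
Proof. exact: lie_prodvP. Qed.

Lemma lie_prodv_ind U V (P : g -> Prop) :
    P 0 -> (forall x y, P x -> P y -> P (x + y)) ->
    (forall (c : E) x, P x -> P (c *: x)) ->
    (forall u v, u \in U -> v \in V -> P (lie u v)) ->
  forall x, x \in lie_prodv U V -> P x.
Proof.
move=> P0 PD PZ PB x; rewrite /lie_prodv.
set s := [seq _ | u <- _, v <- _] => xs.
have /coord_span-> : x \in <<in_tuple s>>%VS by [].
apply: big_ind => // i _; apply: PZ.
have /allpairsP[[u v] /= [uU vV ->]] : s`_i \in s by rewrite mem_nth.
by apply: PB; exact: vbasis_mem.
Qed.

Definition ad_nilpotent x := exists N, forall y, iter N (lie x) y = 0.

(* The conclusion of Engel's theorem for the action of [M] on all subquotients
   [W / U] of the adjoint representation. *)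
Definition engel M := forall U W,
  is_invariant M U -> is_invariant M W -> ~~ (W <= U)%VS ->
  exists w, [/\ w \in W, w \notin U & forall m, m \in M -> lie m w \in U].

(** Start from a vector killed by M modulo U. Since [M, z] is in M, its images under powers of ad z
    are killed by M as well, and the last one outside U is also killed by z. *)
Lemma engel_extend M z : ad_nilpotent z ->
    (forall m, m \in M -> lie m z \in M) -> engel M -> engel (M + <[z]>)%VS.
Proof.
move=> [N zN] Mz eM U W /invariantP UMz /invariantP WMz WU.
have MMz m : m \in M -> m \in (M + <[z]>)%VS by apply: subvP (addvSl _ _) _.
have zMz : z \in (M + <[z]>)%VS by rewrite (subvP (addvSr _ _)) ?memv_line.
have [||w0 [w0W w0U Mw0]] := eM U W _ _ WU.
- by apply/invariantP=> m u /MMz; apply: UMz.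
- by apply/invariantP=> m u /MMz; apply: WMz.
have wj j : iter j (lie z) w0 \in W /\
    forall m, m \in M -> lie m (iter j (lie z) w0) \in U.
  elim: j => [|j [IW IU]] //; rewrite iterS; split; first exact: WMz.
  move=> m mM; rewrite lie_leibniz memvD ?IU ?Mz //.
  by apply: UMz => //; apply: IU.
have ex : exists j, iter j (lie z) w0 \in U by exists N; rewrite zN mem0v.
case: (ex_minnP ex) => [[|j]] jU minj; first by rewrite jU in w0U.
exists (iter j (lie z) w0); have [jW jM] := wj j; split=> //.
  by apply/negP=> /minj; rewrite ltnn.
move=> _ /memv_addP[m mM [_ /vlineP[c ->] ->]].
by rewrite lieDl lieZl memvD ?jM // memvZ.
Qed.

Lemma engel_full : (forall x, ad_nilpotent x) -> engel fullv.
Proof.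
move=> nil; suff grow M : is_subalgebra M -> engel M -> engel fullv.
  apply: (grow 0%VS).
    by apply/lie_prodvP=> u v; rewrite memv0 => /eqP-> _; rewrite lie0l mem0v.
  move=> U W _ _ /subvPn[w wW wU]; exists w; split=> // m.
  by rewrite memv0 => /eqP->; rewrite lie0l mem0v.
have [m] := ubnP (\dim {:g} - \dim M); elim: m M => // m IH M lt Ms eM.
have [fM|fM] := boolP (fullv <= M)%VS.
  by rewrite (_ : fullv = M) //; apply/eqP; rewrite eqEsubv fM subvf.
(* With U = M and W = g, this yields z outside M normalising M, so M + <[z]> is a larger
   subalgebra. *)
have [//||z [_ zM Mz]] := eM M fullv _ _ fM.
  by apply/invariantP=> ? ? _ _; rewrite memvf.
have ltM : (\dim M < \dim (M + <[z]>))%N.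
  rewrite ltn_neqAle dimvS ?addvSl // andbT; apply/eqP=> e.
  have /eqP eM' : M == (M + <[z]>)%VS by rewrite eqEdim addvSl e leqnn.
  by case/negP: zM; rewrite eM' (subvP (addvSr _ _)) ?memv_line.
have ltg : (\dim M < \dim {:g})%N by apply: leq_trans ltM (dimvS (subvf _)).
apply: (IH (M + <[z]>)%VS); last exact: engel_extend.
  apply: leq_trans (_ : (\dim {:g} - \dim M <= m)%N) => //.
  by rewrite ltn_sub2l.
apply/lie_prodvP=> _ _ /memv_addP[a aM [_ /vlineP[c ->] ->]]
  /memv_addP[b bM [_ /vlineP[d ->] ->]].
rewrite lieDl !lieDr !lieZl !lieZr lie_alt !scaler0 addr0.
apply: (subvP (addvSl _ _)); rewrite !memvD ?memvZ ?Mz //.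
  exact: (lie_prodvP _ _ _ Ms).
by rewrite lieC memvN Mz.
Qed.

(* Matrices act on row vectors, so products of matrices are compositions in the
   reverse order. *)
Definition endmx (f : g -> g) := lin1_mx (v2r \o f \o r2v).

Lemma endmxE (f : {linear g -> g}) u : v2r u *m endmx f = v2r (f u).
Proof. by rewrite mul_rV_lin1 /= v2rK. Qed.

Lemma endmx_lfunE (f : 'End(g)) u : v2r u *m endmx f = v2r (f u).
Proof. exact: endmxE. Qed.

Lemma eq_endmx (A B : 'M[E]_(dim g)) :
  (forall u, v2r u *m A = v2r u *m B) -> A = B.
Proof.
by move=> AB; apply/row_matrixP=> i; rewrite !rowE -[delta_mx _ _]r2vK.
Qed.

Definition admx x := endmx (lie x).

Lemma admxE x u : v2r u *m admx x = v2r (lie x u).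
Proof. exact: endmxE. Qed.

Lemma admx_linear : linear admx.
Proof.
move=> c x y; apply: eq_endmx => u.
by rewrite mulmxDr -scalemxAr !admxE lieDl lieZl linearP.
Qed.

Lemma admx_lie x y : admx (lie x y) = admx y *m admx x - admx x *m admx y.
Proof.
apply: eq_endmx => u; rewrite mulmxBr !mulmxA !admxE -linearB /=.
by rewrite [lie x (lie y u)]lie_leibniz addrK.
Qed.

Definition killing x y := \tr (admx x *m admx y).

Lemma killingC x y : killing x y = killing y x.
Proof. exact: mxtrace_mulC. Qed.

Lemma killing_linear y : linear (killing^~ y : g -> E^o).
Proof.
by move=> c x z; rewrite /killing admx_linear mulmxDl -scalemxAl linearP.
Qed.

Lemma killing_lie x y z : killing (lie x y) z = killing x (lie y z).
Proof.
rewrite /killing !admx_lie mulmxBl mulmxBr !raddfB /= !mulmxA; congr (_ - _).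
by rewrite [LHS]mxtrace_mulC [X in \tr X = _]mulmxA [LHS]mxtrace_mulC mulmxA.
Qed.

(** Pairing with a basis of U is a linear map to row vectors. Its kernel is the orthogonal of U, so
    rank-nullity bounds the dimension below even for a degenerate form. *)
Definition orth_coords U x : 'rV[E]_(\dim U) :=
  \row_i killing x (vbasis U)`_i.

Lemma orth_coords_linear U : linear (orth_coords U).
Proof.
by move=> c x y; apply/rowP=> i; rewrite !mxE (killing_linear _ c x y).
Qed.

HB.instance Definition _ U := GRing.isLinear.Build E g _ _ (orth_coords U)
  (orth_coords_linear U).

Definition orthv U := lker (linfun (orth_coords U)).

Lemma orthvP U x :
  reflect (forall u, u \in U -> killing x u = 0) (x \in orthv U).
Proof.
rewrite memv_ker lfunE /=; apply: (iffP eqP) => [x0 u uU|xU].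
  rewrite (coord_vbasis uU) killingC; pose k : g -> E^o := killing^~ x.
  pose kl := GRing.isLinear.Build _ _ _ _ k (killing_linear x).
  pose kL : {linear g -> E^o} := HB.pack k kl.
  rewrite -[LHS]/(kL _) linear_sum big1 // => i _; rewrite linearZ_LR.
  have /rowP/(_ i) := x0; rewrite !mxE killingC => xi.
  by rewrite [kL _]xi scaler0.
by apply/rowP=> i; rewrite !mxE xU // vbasis_mem // mem_nth // size_tuple.
Qed.

Lemma dim_orthv U V : (\dim V <= \dim (V :&: orthv U) + \dim U)%N.
Proof.
rewrite -(limg_ker_dim (linfun (orth_coords U)) V) leq_add2l.
by apply: leq_trans (dimvS (subvf _)) _; rewrite dimvf /dim /= mul1n.
Qed.

Lemma killing0_ad_nilpotent x : [pchar E] =i pred0 ->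
    x \in lie_prodv {:g} {:g} -> (forall y z, killing y z = 0) ->
  ad_nilpotent x.
Proof.
move=> ch0; rewrite /lie_prodv; set s := [seq _ | u <- _, v <- _] => xs k0.
pose a (v : 'rV[E]_(dim g)) := admx (r2v v).
have [||y z||N] := @cartan_nilpotent _ _ a 'I_(size s) (coord (in_tuple s) ^~ x)
  (fun i => v2r s`_i) ch0.
- by move=> c u v; rewrite /a linearP admx_linear.
- move=> y z; rewrite /a -admx_lie; congr admx.
  by rewrite -[y in RHS]r2vK admxE v2rK.
- exact: k0.
- move=> i; have /allpairsP[[u v] /= [_ _ ->]] : s`_i \in s by rewrite mem_nth.
  (* The arguments are swapped because [y *m a z] represents the bracket of z with y. *)
  by exists (v2r v), (v2r u); rewrite /a v2rK admxE.
have -> : \sum_i coord (in_tuple s) i x *: v2r s`_i = v2r x.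
  have {2}-> := coord_span (xs : x \in <<in_tuple s>>%VS).
  by rewrite linear_sum; apply: eq_bigr => i _; rewrite linearZ.
rewrite /a v2rK => XN; exists N => y; apply: (can_inj v2rK).
suff -> : v2r (iter N (lie x) y) = v2r y *m iter N (mulmx (admx x)) 1%:M.
  by rewrite XN mulmx0 linear0.
elim: N {XN} y => [|N IH] y; first by rewrite mulmx1.
by rewrite iterSr IH -admxE iterS mulmxA.
Qed.

(** Perfectness excludes the one-dimensional algebra, whose Killing form is zero. If the radical of
    the form were g, Engel's theorem with U = 0 and W = g would give a nonzero central z; its line,
    an ideal, would be all of g. *)
Lemma killing_nondegenerate : [pchar E] =i pred0 ->
    lie_simple {:g} -> lie_prodv {:g} {:g} = {:g}%VS ->
  forall x, (forall y, killing x y = 0) -> x = 0.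
Proof.
move=> ch0 [g0 simple] perfect x x0; apply/eqP; rewrite -memv0.
have memR u : u \in orthv {:g} <-> forall y, killing u y = 0.
  split=> [/orthvP uR y|uR]; first by rewrite uR ?memvf.
  by apply/orthvP=> y _.
have : is_ideal {:g} (orthv {:g}).
  rewrite /is_ideal subvf; apply/invariantP=> u v _ /memR vR.
  by apply/memR=> y; rewrite killingC -killing_lie killingC vR.
case/simple => [R0|Rg]; first by rewrite -R0; apply/memR.
have nil y : ad_nilpotent y.
  apply: killing0_ad_nilpotent; rewrite ?perfect ?memvf // => u v.
  by move: v; apply/memR; rewrite Rg memvf.
have inv U : U = 0%VS \/ U = {:g}%VS -> is_invariant {:g} U.
  case=> ->; apply/invariantP=> u v _; rewrite ?memvf // !memv0 => /eqP->.
  by rewrite lie0r.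
have ng0 : ~~ ({:g} <= 0)%VS by rewrite subv0; apply/eqP.
have [z [_ z0 gz]] :=
  engel_full nil (inv _ (or_introl erefl)) (inv _ (or_intror erefl)) ng0.
have gzE : <[z]>%VS = {:g}%VS.
  have [] // := simple <[z]>%VS; last first.
    by move=> z1; case/negP: z0; rewrite -z1 memv_line.
  rewrite /is_ideal subvf; apply/invariantP=> u _ _ /vlineP[c ->].
  have := gz u (memvf _); rewrite memv0 lieZr => /eqP->.
  by rewrite scaler0 mem0v.
case: g0; apply/eqP; rewrite -subv0 -{1}perfect; apply/lie_prodvP=> u v _.
rewrite -gzE => /vlineP[c ->]; rewrite lieZr memvZ // gz ?memvf //.
Qed.

(** The hypothesis says that ad h preserves the image of Q; for a projection Q, the trace is that of
    h on this image. Compression by Q respects products, so Q ad [u, v] is a commutator. *)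
Lemma mxtrace_perfect K (Q : 'M_(dim g)) :
    (forall h, h \in K -> Q *m admx h *m Q = Q *m admx h) ->
  forall h, h \in lie_prodv K K -> \tr (Q *m admx h) = 0.
Proof.
move=> QK; have adZ c x : admx (c *: x) = c *: admx x.
  have a0 : admx (0 : g) = 0.
    by apply: eq_endmx => u; rewrite admxE lie0l linear0 mulmx0.
  by rewrite -[c *: x]addr0 admx_linear a0 addr0.
apply: lie_prodv_ind => [|x y x0 y0|c x x0|u v uK vK].
- by rewrite -(scale0r (0 : g)) adZ scale0r mulmx0 raddf0.
- by rewrite -[x]scale1r admx_linear scale1r mulmxDr raddfD /= x0 y0 addr0.
- by rewrite adZ -scalemxAr mxtraceZ x0 mulr0.
have sw a b : b \in K ->
    \tr (Q *m (admx b *m admx a)) = \tr ((Q *m admx b) *m (Q *m admx a)).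
  by move=> bK; rewrite mulmxA -[in LHS](QK b bK) -!mulmxA.
by rewrite admx_lie mulmxBr raddfB /= !sw // mxtrace_mulC subrr.
Qed.

(** The form is that of g restricted to K. If [K, K] were smaller than K, a dimension count would
    give a nonzero x in K orthogonal to it. By invariance and nondegeneracy x is central in K, so it
    spans an abelian ideal. *)
Lemma perfect_of_semisimple K :
    (forall x, x \in K -> (forall y, y \in K -> killing x y = 0) -> x = 0) ->
    is_subalgebra K -> lie_semisimple K -> lie_prodv K K = K.
Proof.
move=> nd Ks ss; apply/eqP; rewrite eqEdim [(_ <= _)%VS]Ks /= leqNgt.
apply/negP=> ltK.
have : (0 < \dim (K :&: orthv (lie_prodv K K)))%N.
  by rewrite -(ltn_add2r (\dim (lie_prodv K K))) (leq_trans ltK) // dim_orthv.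
rewrite lt0n dimv_eq0 => /negP; apply; rewrite -subv0; apply/subvP=> x.
rewrite memv_cap => /andP[xK /orthvP xo].
have xc y : y \in K -> lie x y = 0.
  move=> yK; apply: nd => [|z zK]; first exact: (invariantP _ _ Ks).
  by rewrite killing_lie xo ?mem_lie_prodv.
suff x0 : <[x]>%VS = 0%VS by rewrite -x0 memv_line.
apply: ss.
  rewrite /is_ideal -memvE xK; apply/invariantP=> u _ uK /vlineP[c ->].
    by rewrite lieZr lieC xc // oppr0 scaler0 mem0v.
exists 1%N; apply/eqP; rewrite -subv0; apply/lie_prodvP.
  move=> _ _ /vlineP[c ->] /vlineP[d ->].
  by rewrite lieZl lieZr lie_alt !scaler0 mem0v.
Qed.

End LieTheory.

(** * Involutive automorphisms *)

Section Involution.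
Variables (E : fieldType) (g : lieAlgType E) (sigma : 'End(g)).
Hypotheses (two_neq0 : (2 : E) != 0)
  (sigma_lie : {morph sigma : x y / lie x y})
  (sigmaK : forall x, sigma (sigma x) = x).
Implicit Types (U V W K M N : {vspace g}) (x y z u v w : g).

Local Notation k := (fixedSpace sigma).

Definition antifixed := lker (sigma + \1)%VF.
Local Notation p := antifixed.

Lemma antifixedP x : reflect (sigma x = - x) (x \in p).
Proof.
by rewrite memv_ker add_lfunE id_lfunE addr_eq0; apply: eqP.
Qed.

Definition antifixed_proj : 'End(g) := (2^-1 *: (\1 - sigma))%VF.
Local Notation pp := antifixed_proj.

Lemma antifixed_projE v : pp v = 2^-1 *: (v - sigma v).
Proof. by rewrite scale_lfunE add_lfunE opp_lfunE id_lfunE. Qed.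

Lemma half2 v : 2^-1 *: (v + v) = v.
Proof. by rewrite -mulr2n -scaler_nat scalerA mulVf // scale1r. Qed.

Lemma mem_antifixed_proj v : pp v \in p.
Proof.
apply/antifixedP; rewrite antifixed_projE linearZ linearB /= sigmaK.
by rewrite -scalerN opprB.
Qed.

Lemma antifixed_proj_id v : v \in p -> pp v = v.
Proof. by move/antifixedP=> sv; rewrite antifixed_projE sv opprK half2. Qed.

Lemma fixed_part v : v - pp v = 2^-1 *: (v + sigma v).
Proof.
rewrite -{1}[v]half2 antifixed_projE -scalerBr; congr (_ *: _).
by rewrite opprB addrACA subrr addr0.
Qed.

Lemma mem_fixed_part v : v - pp v \in k.
Proof.
by apply/fixedSpaceP; rewrite fixed_part linearZ linearD /= sigmaK addrC.
Qed.

Lemma fixed_subalgebra : is_subalgebra k.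
Proof.
apply/lie_prodvP=> u v /fixedSpaceP su /fixedSpaceP sv.
by apply/fixedSpaceP; rewrite sigma_lie su sv.
Qed.

Lemma lie_fixed_antifixed x y : x \in k -> y \in p -> lie x y \in p.
Proof.
move=> /fixedSpaceP sx /antifixedP sy; apply/antifixedP.
by rewrite sigma_lie sx sy lieNr.
Qed.

Lemma lie_antifixed x y : x \in p -> y \in p -> lie x y \in k.
Proof.
move=> /antifixedP sx /antifixedP sy; apply/fixedSpaceP.
by rewrite sigma_lie sx sy lieNr lieNl opprK.
Qed.

(** ad (sigma z) is conjugate to ad z under sigma, so the Killing form is sigma-invariant and B(x,
    y) = B(x, -y). *)
Lemma killing_fixed_antifixed x y : x \in k -> y \in p -> killing x y = 0.
Proof.
move=> /fixedSpaceP sx /antifixedP sy.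
have SS : endmx sigma *m endmx sigma = 1%:M.
  by apply: eq_endmx => u; rewrite mulmxA !endmx_lfunE sigmaK mulmx1.
have adS z : admx (sigma z) = endmx sigma *m admx z *m endmx sigma.
  apply: eq_endmx => u.
  by rewrite !mulmxA !(endmx_lfunE, admxE) sigma_lie sigmaK.
have : killing (sigma x) (sigma y) = killing x y.
  rewrite /killing !adS mxtrace_mulC !mulmxA.
  rewrite -(mulmxA _ (endmx sigma) (endmx sigma)) SS mulmx1.
  by rewrite -!mulmxA mxtrace_mulC -!mulmxA SS mulmx1 mxtrace_mulC.
have -> : killing (sigma x) (sigma y) = - killing x y.
  rewrite sx sy /killing -raddfN -mulmxN; congr (\tr (_ *m _)).
  by apply: eq_endmx => u; rewrite mulmxN !admxE lieNl linearN.
move=> /eqP; rewrite eq_sym -subr_eq0 opprK -mulr2n -mulr_natl mulf_eq0.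
by rewrite (negPf two_neq0) => /eqP.
Qed.

(* With [P] and [Q] the projections onto [p] and [N], one finds
   tr (P Y X) = tr (Q [x, y]) and tr ((1 - P) Y X) = tr (P X Y)
   = tr (P Y X) - tr (P [x, y]), where both traces of [x, y] vanish. *)
Lemma killing_isotropic N : lie_prodv k k = k -> (N <= p)%VS ->
    is_invariant k N -> (forall x y, x \in N -> y \in N -> lie x y = 0) ->
  forall x y, x \in N -> y \in p -> killing x y = 0.
Proof.
move=> perfect Np /invariantP kN abN x y xN yp.
have xp := subvP Np x xN; have hk := lie_antifixed xp yp.
pose Q := endmx (projv N); pose P := endmx pp.
(* For v in p, [y, v] is in k, so [x, [y, v]] is in N. *)
have PxyN : P *m admx y *m admx x *m Q = P *m admx y *m admx x.
  apply: eq_endmx => v; rewrite !mulmxA !(endmx_lfunE, admxE) projv_id //.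
  by rewrite lieC memvN kN // lie_antifixed ?mem_antifixed_proj.
have QP : Q *m P = Q.
  apply: eq_endmx => v; rewrite !mulmxA !endmx_lfunE antifixed_proj_id //.
  by rewrite (subvP Np) ?memv_proj.
have QX : Q *m admx x = 0.
  apply: eq_endmx => v; rewrite !mulmxA endmx_lfunE admxE abN ?memv_proj //.
  by rewrite linear0 mulmx0.
(* tr (P Y X) = tr (P Y X Q) = tr (Q Y X), and this is the trace of Q ad [x, y] because Q X = 0. *)
have trP : \tr (P *m admx y *m admx x) = 0.
  have := mxtrace_perfect (K := k) (Q := Q) _ (h := lie x y).
  rewrite perfect admx_lie mulmxBr mulmxA [Q *m (admx x *m _)]mulmxA QX.
  rewrite mul0mx subr0.
  move=> <- //; first by rewrite -PxyN mxtrace_mulC !mulmxA QP.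
  move=> h hk'; apply: eq_endmx => v.
  rewrite !mulmxA !(endmx_lfunE, admxE) projv_id //.
  by rewrite kN ?memv_proj.
(* ad y exchanges k and p, so projecting to p after it amounts to projecting to k before it. *)
have YP : admx y *m P = admx y - P *m admx y.
  apply: eq_endmx => v; rewrite mulmxBr !mulmxA !(endmx_lfunE, admxE) -linearB.
  congr v2r; rewrite -lieNr -lieDr fixed_part lieZr lieDr antifixed_projE.
  by rewrite sigma_lie (antifixedP _ yp) lieNl opprK.
have PP : P *m P = P.
  apply: eq_endmx => v.
  by rewrite !mulmxA !endmx_lfunE antifixed_proj_id ?mem_antifixed_proj.
have trPh : \tr (P *m admx (lie x y)) = 0.
  apply: (mxtrace_perfect (K := k)); last by rewrite perfect.
  move=> h hk'; apply: eq_endmx => v; rewrite !mulmxA !(endmx_lfunE, admxE).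
  by rewrite antifixed_proj_id // lie_fixed_antifixed ?mem_antifixed_proj.
rewrite killingC /killing -[admx y](subrK (P *m admx y)) -YP.
rewrite mulmxDl raddfD /= trP addr0.
rewrite -mulmxA mxtrace_mulC; move: trPh.
rewrite admx_lie mulmxBr !mulmxA raddfB /= trP sub0r => /eqP.
by rewrite oppr_eq0 => /eqP.
Qed.

Lemma invariant_containing_fixed V :
    [pchar E] =i pred0 -> lie_simple {:g} -> lie_semisimple k ->
    is_invariant k V -> (k <= V)%VS -> V = k \/ V = {:g}%VS.
Proof.
move=> ch0 simple ss Vinv kV; have [_ simpleE] := simple.
(* If g is abelian, V is itself an ideal; the case V = 0 forces k = 0 = V. *)
have [gg0|gg] : lie_prodv {:g} {:g} = 0%VS \/ lie_prodv {:g} {:g} = {:g}%VS.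
- apply: simpleE; rewrite /is_ideal subvf.
  by apply/invariantP=> u v _ _; rewrite mem_lie_prodv ?memvf.
- have [|V0|] := simpleE V; [|left|by right].
    rewrite /is_ideal subvf; apply/invariantP=> u v _ _.
    have : lie u v \in lie_prodv {:g} {:g} by rewrite mem_lie_prodv ?memvf.
    by rewrite gg0 memv0 => /eqP->; rewrite mem0v.
  by apply/eqP; rewrite eqEsubv kV V0 sub0v.
have nondeg := killing_nondegenerate ch0 simple gg.
have dec x : x = (x - pp x) + pp x by rewrite subrK.
have killDr x y z : killing x (y + z) = killing x y + killing x z.
  by rewrite -[y]scale1r !(killingC x) [LHS]killing_linear !scale1r.
have kdec x : (forall y, y \in k -> killing x y = 0) ->
    (forall y, y \in p -> killing x y = 0) -> x = 0.
  move=> xk xp; apply: nondeg => y; rewrite [y]dec killDr.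
  by rewrite xk ?xp ?addr0 ?mem_fixed_part ?mem_antifixed_proj.
have perfect : lie_prodv k k = k.
  apply: perfect_of_semisimple => //; last exact: fixed_subalgebra.
  by move=> x xk x0; apply: kdec => // y; apply: killing_fixed_antifixed.
pose W := (V :&: p)%VS; pose W' := (orthv W :&: p)%VS.
have kp_inv U : is_invariant k U -> is_invariant k (U :&: p)%VS.
  move=> /invariantP kU; apply/invariantP=> h u hk.
  rewrite !memv_cap => /andP[uU up].
  by rewrite kU // lie_fixed_antifixed.
have kW : is_invariant k W := kp_inv _ Vinv.
have kW' : is_invariant k W'.
  apply: kp_inv; apply/invariantP=> h u hk /orthvP uW; apply/orthvP=> w wW.
  rewrite killingC -killing_lie killingC uW // lieC memvN.
  exact: (invariantP _ _ kW).
(* [w, w'] lies in k, and B([w, w'], h) = B(w, [w', h]) = 0 for h in k, as [w', h] stays in W'. *)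
have WW' w w' : w \in W -> w' \in W' -> lie w w' = 0.
  move=> wW w'W'; have [/andP[wV wp] /andP[w'o w'p]] :
    (w \in V) && (w \in p) /\ (w' \in orthv W) && (w' \in p).
    by rewrite -!memv_cap.
  have ww'k := lie_antifixed wp w'p.
  apply: kdec => [h hk|y]; last exact: killing_fixed_antifixed.
  have : lie w' h \in W' by rewrite lieC memvN (invariantP _ _ kW').
  by rewrite memv_cap killing_lie killingC => /andP[/orthvP-> ].
pose N := (W :&: W')%VS.
have N0 : N = 0%VS.
  have isoN : forall x y, x \in N -> y \in p -> killing x y = 0.
    apply: killing_isotropic => //.
    - by apply/subvP=> x; rewrite !memv_cap => /andP[/andP[]].
    - apply/invariantP=> h x hk; rewrite !(memv_cap _ W) => /andP[xW xW'].
      by rewrite (invariantP _ _ kW) ?(invariantP _ _ kW').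
    - move=> x y; rewrite !(memv_cap _ W).
      by move=> /andP[xW _] /andP[_ /(WW' _ _ xW)].
  apply/eqP; rewrite -subv0; apply/subvP=> x xN; rewrite memv0; apply/eqP.
  apply: kdec => [h hk|y]; last exact: isoN.
  rewrite killingC killing_fixed_antifixed //.
  by move: xN; rewrite !memv_cap => /andP[/andP[]].
have WW'p : (W + W' = p)%VS.
  (* W and W' meet in N = 0, and dim p is at most dim W' + dim W. *)
  apply/eqP; rewrite eqEdim subv_add !capvSr /= dimv_disjoint_sum //.
  by rewrite addnC (leq_trans (dim_orthv W p)) // capvC.
pose I := (W + lie_prodv W W)%VS.
have WI x : x \in W -> x \in I by apply: subvP (addvSl _ _) _.
have WWI x : x \in lie_prodv W W -> x \in I by apply: subvP (addvSr _ _) _.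
have WWk x : x \in lie_prodv W W -> x \in k.
  apply: subvP; apply/lie_prodvP=> u v; rewrite !memv_cap.
  by move=> /andP[_ up] /andP[_ vp]; apply: lie_antifixed.
have idI : is_ideal {:g} I.
  rewrite /is_ideal subvf; apply/invariantP=> u x _ xI.
  (* Split u into parts in k, W and W'. The first preserves W and [W, W], the second sends W into
     [W, W] and [W, W], which lies in k, into W; the third commutes with W, hence with I. *)
  have [w wW [w' w'W' uE]] : exists2 w, w \in W &
      exists2 w', w' \in W' & u = (u - pp u) + (w + w').
    have := mem_antifixed_proj u; rewrite -WW'p => /memv_addP[w wW [w' w'W' e]].
    by exists w => //; exists w'; rewrite // -e subrK.
  have hk := mem_fixed_part u; move: (u - pp u) hk uE => h hk ->.
  have w'x : lie w' x = 0.
    have w'W0 y : y \in W -> lie w' y = 0 by move=> yW; rewrite lieC WW' ?oppr0.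
    case/memv_addP: xI => y yW [z zWW ->].
    rewrite lieDr w'W0 // add0r.
    move: z zWW; apply: lie_prodv_ind => [|a b a0 b0|c a a0|a b aW bW].
    - exact: lie0r.
    - by rewrite lieDr a0 b0 addr0.
    - by rewrite lieZr a0 scaler0.
    - by rewrite lie_leibniz !w'W0 // lie0l lie0r addr0.
  rewrite !lieDl w'x addr0; apply: memvD.
    case/memv_addP: xI => y yW [z zWW ->].
    rewrite lieDr; apply: memvD; first by rewrite WI ?(invariantP _ _ kW).
    move: z zWW; apply: (@lie_prodv_ind _ _ _ _ (fun z => lie h z \in I))
      => [|a b|c a|a b aW bW].
    - by rewrite lie0r mem0v.
    - by rewrite lieDr; apply: memvD.
    - by rewrite lieZr; apply: memvZ.
    - rewrite lie_leibniz memvD // WWI // mem_lie_prodv //;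
        by rewrite (invariantP _ _ kW).
  case/memv_addP: xI => y yW [z zWW ->].
  rewrite lieDr; apply: memvD; first by rewrite WWI ?mem_lie_prodv.
  by rewrite WI // lieC memvN (invariantP _ _ kW) // WWk.
(* If I = 0 then W = 0, so V has no part in p; if I = g then V = g, since W and [W, W], being in k,
   both lie in V. *)
have [I0|Ig] := simpleE _ idI; [left|right].
  apply/eqP; rewrite eqEsubv kV andbT; apply/subvP=> v vV.
  have : pp v \in W.
    rewrite memv_cap mem_antifixed_proj andbT -[pp v](subKr v) memvB //.
    by rewrite (subvP kV) ?mem_fixed_part.
  by move/WI; rewrite I0 memv0 => /eqP pv; rewrite -[v]subr0 -pv mem_fixed_part.
apply/eqP; rewrite eqEsubv subvf /= -Ig subv_add capvSl /=.
by apply: subv_trans kV; apply/subvP.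
Qed.

End Involution.

Theorem mainTheorem3 (E : fieldType) (char0 : [pchar E] =i pred0)
    (g : lieAlgType E) (g_simple : lie_simple (fullv : {vspace g}))
    (sigma : 'End(g)) (sigma_aut : is_lie_automorphism sigma)
    (sigma_neq1 : sigma <> \1%VF) (sigma_inv : (sigma \o sigma)%VF = \1%VF)
    (k : {vspace g}) (k_def : k = fixedSpace sigma)
    (k_semisimple : lie_semisimple k) :
  (forall V : {vspace g}, is_invariant k V -> (k <= V)%VS ->
     V = k \/ V = fullv)
  /\ is_maximal_subalgebra k.
Proof.
have two_neq0 : (2 : E) != 0 by move/pcharf0P: char0 => ->.
have sigmaK x : sigma (sigma x) = x.
  by rewrite -comp_lfunE sigma_inv id_lfunE.
have [_ sigma_lie] := sigma_aut; rewrite {}k_def in k_semisimple *.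
have inv V : is_invariant (fixedSpace sigma) V -> (fixedSpace sigma <= V)%VS ->
    V = fixedSpace sigma \/ V = fullv.
  exact: invariant_containing_fixed.
split=> //; split=> [|kg|M Msub kM].
- exact: fixed_subalgebra.
- apply: sigma_neq1; apply/lfunP=> x; rewrite id_lfunE; apply/fixedSpaceP.
  by rewrite kg memvf.
(* A subalgebra containing k is k-invariant. *)
- apply: inv => //; apply/lie_prodvP=> u v uk vM.
  by apply: (lie_prodvP _ _ _ Msub) => //; apply: (subvP kM).
Qed.
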